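(* Work in either the function setting (put $\Omega=\Omega_{\mathrm{fun}}$) or the operator setting (put $\Omega=\Omega_{\mathrm{op}}$). Let $M_0,M_N,M_0',M_N'\in\mathbb{S}^2_+$, and let $\tilde H\in\mathbb{R}^{\mathcal I_N\times\mathcal I_N}$ be strictly lower triangular. Suppose that $\tilde H$ is extremal for $(M_0,M_N)$ and that $\tilde H^A$ is extremal for $(M_0',M_N')$. Suppose furthermore that $$\frac{d_\sigma^* M_N d_\sigma}{d_\sigma^* M_0 d_\sigma}=\frac{d_\sigma^* M_N' d_\sigma}{d_\sigma^* M_0' d_\sigma}\qquad\text{for all }\sigma\in\Omega,$$ and that the denominators are nonzero for all $\sigma\in\Omega$. Then $$\tau_{\mathrm{PEP}}^{M_0,M_N}(\tilde H)=\tau_{\mathrm{PEP}}^{M_0',M_N'}(\tilde H^A).$$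
   Context: Fix an integer $N\ge 1$, $\mathcal I_N=\{0,\dots,N\}$, $\mu\in[0,1)$ and $q=\mu/(1-\mu)$. $\mathbb{S}^2_+$ is the set of real symmetric PSD $2\times2$ matrices; ${}^*$ is conjugate transpose. $\mathbb{1}$ is the all-ones vector, $S\in\mathbb{R}^{\mathcal I_N\times\mathcal I_N}$ has ones on and below the diagonal and zeros elsewhere, $R$ is the reversal permutation matrix (ones on the antidiagonal), and the antitranspose is $X^A=RX^\intercal R$. For strictly lower triangular $\tilde H$ put $H=(S^{-1}+\tilde H)((1+q)I+qS\tilde H)^{-1}$ and $v_H=(I-qSH)\mathbb{1}$. Elements of $\mathbb{R}^d$ are row vectors. Given $y_0\in\mathbb{R}^d$ and $\mathbf g\in\mathbb{R}^{\mathcal I_N\times d}$ (rows $g_i$), define $\mathbf x=-SH\mathbf g+v_Hy_0$, $\mathbf s=\mathbf g+q\mathbf x$, $\mathbf y=\mathbf x+\mathbf s$, with rows $x_i,s_i,y_i$ (row $0$ of $\mathbf y$ is the given $y_0$; equivalently $y_n=y_{n-1}-\sum_{i<n}\tilde H_{n,i}s_i$, $x_i=y_i-s_i$, $g_i=s_i-qx_i$). For $M\in\mathbb{S}^2_+$ let $Q_M(y,s)=\mathrm{tr}\left(\begin{bmatrix}y\\ s\end{bmatrix}^\intercal M\begin{bmatrix}y\\ s\end{bmatrix}\right)$ and $$\mathrm{Slack}^{M_0,M_N}_{\tau,\Lambda,\tilde H}(y_0,\mathbf g)=\tfrac{\tau}{2}Q_{M_0}(y_0,s_0)-\tfrac1{2\tau}Q_{M_N}(y_N,s_N)+\mathrm{tr}(\mathbf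 g^\intercal\Lambda\mathbf x).$$ $\mathcal P_{\mathrm{cert}}$ is the set of square real matrices with nonnegative off-diagonal entries, nonpositive row sums and nonpositive column sums. The PEP rate $\tau_{\mathrm{PEP}}^{M_0,M_N}(\tilde H)$ is the infimum of $\tau>0$ for which there is $\Lambda\in\mathbb{R}^{\mathcal I_N\times\mathcal I_N}$ with $\Lambda\in\mathcal P_{\mathrm{cert}}$ and $\mathrm{Slack}^{M_0,M_N}_{\tau,\Lambda,\tilde H}(y_0,\mathbf g)\ge0$ for all $(y_0,\mathbf g)$; in the operator setting $\Lambda$ is additionally required to be symmetric. Extremal trajectories: $\Omega_{\mathrm{fun}}=\{\mu,1\}$ (function setting) and $\Omega_{\mathrm{op}}=\{\sigma\in\mathbb{C}:|\sigma-\frac{1+\mu}2|=\frac{1-\mu}2\}$ (operator setting). For $\sigma\in\Omega$, $d_\sigma=\begin{bmatrix}1\\ \sigma\end{bmatrix}$. An extremal trajectory of $\tilde H$ is one with $s_i=\sigma y_i$ for all $i\in\mathcal I_N$ for some fixed $\sigma\in\Omega$, where the $y_i$ are in $\mathbb{R}$ in the function setting, and in $\mathbb{C}\cong\mathbb{R}^2$ in the operator setting (with $y_n=y_{n-1}-\sum_{i<n}\tilde H_{n,i}s_i$). (These correspond to the function $\frac\sigma2y^2$ and the operator $T_\sigma(y)=(1-\frac{2\sigma}{1+\mu})y$.) $\tilde H$ is extremal for $(M_0,M_N)$ if, with $\tau=\tau_{\mathrm{PEP}}^{M_0,M_N}(\tilde H)$, the equality $\frac\tau2Q_{M_0}(y_0,s_0)-\frac1{2\tau}Q_{M_N}(y_N,s_N)=0$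 holds for some extremal trajectory with $y_0\ne0$. *)

(* Defs.v *)
From HB Require Import structures.
From mathcomp Require Import all_boot all_order all_algebra.
From mathcomp Require Import classical_sets reals constructive_ereal ereal.
From mathcomp Require Import complex.

Set Implicit Arguments.
Unset Strict Implicit.
Unset Printing Implicit Defensive.

Import Order.TTheory GRing.Theory Num.Theory.
Local Open Scope classical_set_scope.
Local Open Scope ring_scope.
Local Open Scope complex_scope.
Local Open Scope sesquilinear_scope.

(* The index set {0, ..., N} is 'I_N.+1. *)

Inductive setting := function_setting | operator_setting.

Definition psd2 (R : realType) (M : 'M[R]_2) : Prop :=
  M^T = M /\ forall v : 'cV[R]_2, 0 <= (v^T *m M *m v) ord0 ord0.

Section Matrices.
Variables (R : realType) (N : nat).
Implicit Types (mu : R) (Ht X : 'M[R]_N.+1).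

Definition strictly_lower X : Prop :=
  forall i j : 'I_N.+1, (i <= j)%N -> X i j = 0.

Definition Smx : 'M[R]_N.+1 := \matrix_(i, j) ((j <= i)%N)%:R.

Definition revmx : 'M[R]_N.+1 := \matrix_(i, j) (i == rev_ord j)%:R.

Definition antitrmx X : 'M[R]_N.+1 := revmx *m X^T *m revmx.

Definition qof mu : R := mu / (1 - mu).

(* When Ht is strictly lower triangular and 0 <= mu < 1, the matrix inverted
   here is lower triangular with diagonal entries 1 + q > 0. *)
Definition Hmx mu Ht : 'M[R]_N.+1 :=
  let q := qof mu in
  (invmx Smx + Ht) *m invmx ((1 + q) *: 1%:M + q *: (Smx *m Ht)).

Definition vH mu Ht : 'cV[R]_N.+1 :=
  (1%:M - qof mu *: (Smx *m Hmx mu Ht)) *m const_mx 1.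

Definition Pcert (L : 'M[R]_N.+1) : Prop :=
  [/\ forall i j, i != j -> 0 <= L i j,
      forall i, \sum_j L i j <= 0
    & forall j, \sum_i L i j <= 0].

End Matrices.

Definition Qform (R : realType) d (M : 'M[R]_2) (y s : 'rV[R]_d) : R :=
  let ys : 'M[R]_(2, d) := col_mx y s in \tr (ys^T *m M *m ys).

Section Rate.
Variables (R : realType) (N : nat).
Implicit Types (mu tau : R) (Ht L : 'M[R]_N.+1).

Definition xmx d mu Ht (y0 : 'rV[R]_d) (g : 'M[R]_(N.+1, d)) :=
  - (Smx R N *m Hmx mu Ht *m g) + vH mu Ht *m y0.

Definition smx d mu Ht (y0 : 'rV[R]_d) (g : 'M[R]_(N.+1, d)) :=
  g + qof mu *: xmx mu Ht y0 g.

Definition ymx d mu Ht (y0 : 'rV[R]_d) (g : 'M[R]_(N.+1, d)) :=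
  xmx mu Ht y0 g + smx mu Ht y0 g.

Definition Slack d mu (M0 MN : 'M[R]_2) tau L Ht
    (y0 : 'rV[R]_d) (g : 'M[R]_(N.+1, d)) : R :=
  let x := xmx mu Ht y0 g in
  let s := smx mu Ht y0 g in
  let y := ymx mu Ht y0 g in
  tau / 2 * Qform M0 y0 (row ord0 s)
  - 1 / (2 * tau) * Qform MN (row ord_max y) (row ord_max s)
  + \tr (g^T *m L *m x).

Definition certifies (st : setting) mu (M0 MN : 'M[R]_2) tau Ht L : Prop :=
  [/\ Pcert L,
      (if st is operator_setting then L^T = L else True)
    & forall (d : nat) (y0 : 'rV[R]_d) (g : 'M[R]_(N.+1, d)),
        0 <= Slack mu M0 MN tau L Ht y0 g].

(* An extended real: +oo when no tau > 0 admits a certificate. *)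
Definition tauPEP (st : setting) mu (M0 MN : 'M[R]_2) Ht : \bar R :=
  ereal_inf [set tau%:E | tau in
    [set tau : R | 0 < tau /\ exists L, certifies st mu M0 MN tau Ht L]].

End Rate.

Section Extremal.
Variables (R : realType) (N : nat).
Implicit Types (mu tau : R) (Ht : 'M[R]_N.+1).

Definition OmegaFun mu : set R := [set sigma | sigma = mu \/ sigma = 1].

Definition OmegaOp mu : set R[i] :=
  [set sigma | `|sigma - ((1 + mu) / 2)%:C| = ((1 - mu) / 2)%:C].

Definition Omega (st : setting) mu : set R[i] :=
  match st with
  | function_setting => [set sigma%:C | sigma in OmegaFun mu]
  | operator_setting => OmegaOp mu
  end.

Definition dvec (sigma : R[i]) : 'cV[R[i]]_2 :=
  \col_(i < 2) (if i == ord0 then 1 else sigma).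

Definition dform (M : 'M[R]_2) (sigma : R[i]) : R[i] :=
  ((dvec sigma)^t* *m map_mx (real_complex R) M *m dvec sigma) ord0 ord0.

Definition iterates d Ht (y s : 'M[R]_(N.+1, d)) : Prop :=
  forall m n : 'I_N.+1, n = m.+1 :> nat ->
    row n y = row m y - \sum_(i < N.+1 | (i < n)%N) Ht n i *: row i s.

(* The identification of C with R^2, applied to each entry of a column. *)
Definition realify (z : 'cV[R[i]]_N.+1) : 'M[R]_(N.+1, 2) :=
  row_mx (map_mx (@complex.Re R) z) (map_mx (@complex.Im R) z).

Definition attains_rate d (M0 MN : 'M[R]_2) tau Ht (y s : 'M[R]_(N.+1, d)) : Prop :=
  [/\ iterates Ht y s,
      row ord0 y != 0
    & tau / 2 * Qform M0 (row ord0 y) (row ord0 s)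
      - 1 / (2 * tau) * Qform MN (row ord_max y) (row ord_max s) = 0].

(* The factor 1 / (2 * tau) only makes sense when the rate is finite and
   nonzero, which is therefore part of the definition. *)
Definition extremal (st : setting) mu (M0 MN : 'M[R]_2) Ht : Prop :=
  exists tau : R, [/\ 0 < tau, tauPEP st mu M0 MN Ht = tau%:E &
    match st with
    | function_setting =>
        exists (sigma : R) (y : 'cV[R]_N.+1),
          OmegaFun mu sigma /\ attains_rate M0 MN tau Ht y (sigma *: y)
    | operator_setting =>
        exists (sigma : R[i]) (y : 'cV[R[i]]_N.+1),
          OmegaOp mu sigma /\
          attains_rate M0 MN tau Ht (realify y) (realify (sigma *: y))
    end].

End Extremal.

(* Main.v *)
Require Import Defs.
From mathcomp Require Import all_boot all_order all_algebra.
From mathcomp Require Import classical_sets reals constructive_ereal ereal.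
From mathcomp Require Import complex.
From mathcomp Require Import ring lra zify.

(** Write w_M(sigma) for the real number d_sigma^* M d_sigma.  For a fixed
    sigma, an extremal trajectory is determined by its start:
    y_N = p(sigma) y_0 for a polynomial p depending on Ht, so both sides of the
    performance inequality scale with |y_0|^2.  For an extremal Ht the rate
    is the square root of the maximum over Omega of
    |p(sigma)|^2 w_MN(sigma) / w_M0(sigma), and p is the same for Ht and its
    antitranspose.

    Lower bound on the rate ([tauPEP_bound]).  On an extremal trajectory the
    certificate term tr(g^T Lambda x) vanishes for every admissible Lambda
    ([trace_extremal]): in the function setting either x = 0 (sigma = 1) or
    g = 0 (sigma = mu); in the operator setting x and g are the multiples
    1 - sigma and sigma - q (1 - sigma) of y, the circle condition makes these
    two complex numbers orthogonal as vectors of the plane, and a symmetric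
    Lambda only sees their scalar product.  Nonnegativity of the slack
    therefore reads |y_N|^2 w_MN <= tau^2 |y_0|^2 w_M0 for every certified tau,
    and this passes to the infimum.  Extremality says that equality holds for
    some sigma ([extremal_attained]).

    Antitransposition ([trajectory_antitr]).  A trajectory solves
    (S^-1 + sigma Ht) y = y_0 e_0.  The difference matrix S^-1 is its own
    antitranspose, so a trajectory of the antitranspose of Ht solves the system
    of the antitransposed matrix.  The reversed second solution solves the
    transposed system with right-hand side along e_N, and pairing it with the
    first solution gives y_0 y'_N = y'_0 y_N ([antitranspose_reciprocity]).

    Hence a sigma attaining the rate for Ht gives, by the lower bound applied
    at that same sigma, that the rate for Ht is at most the rate for its
    antitranspose ([tauPEP_le_antitrmx]); antitransposition is an involution,
    so the reverse inequality is the same statement. *)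

Import Order.TTheory GRing.Theory Num.Theory.
Local Open Scope ring_scope.
Set Implicit Arguments.
Unset Strict Implicit.

(** * The difference matrix and the two forms of an iteration *)

(** The inverse of the summation matrix [Smx]. *)
Definition diffmx (K : pzRingType) (N : nat) : 'M[K]_N.+1 :=
  \matrix_(i, j) ((i == j)%:R - (i == j.+1 :> nat)%:R).

Lemma Smx_diff (R : realType) (N : nat) : Smx R N *m diffmx R N = 1%:M.
Proof.
apply/matrixP => i j; rewrite !mxE.
under eq_bigr => k _ do rewrite !mxE mulrBr -!natrM !mulnb.
rewrite sumrB -!natr_sum.
have E (P : pred nat) (m : nat) :
    (\sum_(k < N.+1) (P k && (k == m :> nat)) = ((m < N.+1) && P m)%N)%N.
  have [lm|lm] /= := ltnP m N.+1.
    rewrite (bigD1 (Ordinal lm)) //= eqxx andbT big1 ?addn0 // => k.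
    by rewrite -val_eqE /= => /negbTE ->; rewrite andbF.
  rewrite big1 // => k _; case: eqP => [km|_]; last by rewrite andbF.
  by move: (ltn_ord k); rewrite km ltnNge lm.
rewrite (E (fun k => (k <= i)%N) j) (E (fun k => (k <= i)%N) j.+1).
rewrite ltn_ord /=.
have -> : (j.+1 < N.+1)%N && (j < i)%N = (j < i)%N.
  by case: (ltnP j i) => h; rewrite ?andbF // andbT (leq_trans _ (ltn_ord i)).
rewrite -(inj_eq val_inj) /=.
by case: (ltngtP i j) => _; rewrite ?subrr ?subr0.
Qed.

(** Stacking the recursions y_n - y_(n-1) = - sum_i Ht n i s_i for n >= 1; row 0
    is the tautology y_0 = y_0, because row 0 of [Ht] is zero. *)
Lemma iteratesP (R : realType) (N d : nat) (Ht : 'M[R]_N.+1)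
    (y s : 'M[R]_(N.+1, d)) :
  strictly_lower Ht ->
  iterates Ht y s <->
  diffmx R N *m y + Ht *m s = (delta_mx ord0 ord0 : 'cV_N.+1) *m row ord0 y.
Proof.
move=> hHt.
have sumlt (n : 'I_N.+1) k :
    (\sum_(i < N.+1 | (i < n)%N) Ht n i *: row i s) 0 k = \sum_i Ht n i * s i k.
  rewrite summxE [RHS](bigID (fun i : 'I_N.+1 => (i < n)%N)) /=.
  rewrite [X in _ + X]big1 ?addr0 => [|i]; last first.
    by rewrite -leqNgt => /hHt ->; rewrite mul0r.
  by apply: eq_bigr => i _; rewrite !mxE.
have diffE (n : 'I_N.+1) k : (diffmx R N *m y) n k =
    y n k - \sum_(m < N.+1 | (n == m.+1 :> nat)) y m k.
  rewrite mxE.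
  under eq_bigr => i _ do rewrite mxE mulrBl.
  rewrite sumrB; congr (_ - _).
    rewrite (bigD1 n) //= eqxx mul1r big1 ?addr0 // => i /negbTE.
    by rewrite eq_sym => ->; rewrite mul0r.
  rewrite [RHS]big_mkcond; apply: eq_bigr => i _.
  by case: eqP; rewrite ?mul1r ?mul0r.
split=> [it|E m n nm].
  apply/matrixP => n k; rewrite [LHS]mxE diffE [RHS]mxE big_ord1 !mxE eqxx andbT.
  have [n0|n0] := eqVneq n ord0.
    rewrite n0 mul1r big1 // subr0 big1 ?addr0 // => i _.
    by rewrite hHt ?mul0r.
  have [m nm] : exists m : 'I_N.+1, n = m.+1 :> nat.
    have hm : (n.-1 < N.+1)%N by rewrite (leq_ltn_trans (leq_pred _)).
    exists (Ordinal hm).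
    by rewrite /= prednK // lt0n; apply: contra n0 => /eqP n0; apply/eqP/val_inj.
  have /rowP/(_ k) := it _ _ nm.
  rewrite !mxE sumlt => ->.
  rewrite mul0r [X in _ - X + _](big_pred1 m) => [|i]; first by ring.
  by rewrite nm eqSS eq_sym.
apply/rowP => k; rewrite !mxE sumlt.
move/matrixP/(_ n k): E; rewrite [LHS]mxE diffE [RHS]mxE big_ord1 !mxE.
have -> : (n == ord0) = false by apply/negP => /eqP n0; rewrite n0 in nm.
rewrite mul0r (big_pred1 m) => [|i]; last by rewrite nm eqSS eq_sym.
by move/eqP; rewrite addrAC subr_eq0 => /eqP <-; rewrite addrK.
Qed.

Lemma Smx_delta (R : realType) (N : nat) :
  Smx R N *m (delta_mx ord0 ord0 : 'cV_N.+1) = const_mx 1.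
Proof.
apply/matrixP => i j; rewrite !mxE (bigD1 ord0) //= big1 => [|k k0].
  by rewrite !mxE eqxx ord1 eqxx mul1r addr0.
by rewrite !mxE (negbTE k0) mulr0.
Qed.

Lemma strictly_lower_Smx (R : realType) (N : nat) (Ht : 'M[R]_N.+1) :
  strictly_lower Ht -> strictly_lower (Smx R N *m Ht).
Proof.
move=> hHt i j ij; rewrite mxE big1 // => k _; rewrite mxE.
have [ki|_] := leqP k i; last by rewrite mul0r.
by rewrite hHt ?mulr0 // (leq_trans ki).
Qed.

(** Consistency of the closed form defining x, s, y from g with the recursion:
    with K = S Ht and D = (1 + q) I + q K one has S H = (I + K) D^-1 and
    I - q S H = D^-1, and K commutes with D, so the claim becomes
    D x = 1 y_0 - (I + K) g, which is the summed recursion y = 1 y_0 - K s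
    rewritten with s = g + q x and y = x + s. *)
Lemma xmx_iterates (R : realType) (N d : nat) (mu : R) (Ht : 'M[R]_N.+1)
    (y s : 'M[R]_(N.+1, d)) :
  0 <= mu < 1 -> strictly_lower Ht -> iterates Ht y s ->
  xmx mu Ht (row ord0 y) (s - qof mu *: (y - s)) = y - s.
Proof.
move=> /andP[mu0 mu1] hHt /(iteratesP _ _ hHt) /(congr1 (mulmx (Smx R N))).
rewrite mulmxDr !mulmxA Smx_diff mul1mx Smx_delta /xmx /vH.
set q := qof mu; set K := Smx R N *m Ht => yE.
have q0 : 0 <= q by rewrite divr_ge0 // subr_ge0 ltW.
have hK : strictly_lower K := strictly_lower_Smx hHt.
have [Su _] := mulmx1_unit (Smx_diff R N).
pose D := (1 + q) *: 1%:M + q *: K.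
have DE i j : D i j = (1 + q) * (i == j)%:R + q * K i j.
  rewrite mxE [X in X + _]mxE [X in _ + X]mxE.
  by congr (_ * _ + _); rewrite mxE.
have Du : D \in unitmx.
  rewrite unitmxE det_trig; last first.
    apply/is_trig_mxP => i j ij.
    by rewrite DE (hK _ _ (ltnW ij)) -val_eqE (ltn_eqF ij) !mulr0 addr0.
  rewrite unitfE; apply/prodf_neq0 => i _.
  by rewrite DE eqxx hK // mulr0 addr0 mulr1 gt_eqF // ltr_wpDr.
have SH : Smx R N *m Hmx mu Ht = (1%:M + K) *m invmx D.
  by rewrite /Hmx -/q -/K -/D mulmxA mulmxDr mulmxV.
have comm : (1%:M + K) *m invmx D = invmx D *m (1%:M + K).
  have cD : D *m (1%:M + K) = (1%:M + K) *m D.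
    rewrite mulmxDr mulmxDl mulmx1 mul1mx; congr (_ + _).
    by rewrite /D mulmxDl mulmxDr -!scalemxAl -!scalemxAr mul1mx mulmx1.
  rewrite -[RHS](mulmxK Du) -[invmx D *m _ *m D]mulmxA -cD mulmxA mulVmx //.
  by rewrite mul1mx.
have vE : 1%:M - q *: (Smx R N *m Hmx mu Ht) = invmx D.
  rewrite SH scalemxAl -{1}(mulmxV Du) -mulmxBl.
  have -> : D - q *: (1%:M + K) = 1%:M.
    by rewrite /D scalerDr scalerDl scale1r opprD addrACA addrK subrr addr0.
  by rewrite mul1mx.
rewrite vE SH comm -!mulmxA -yE addrC -mulmxBr.
apply: (canLR (mulKmx Du)).
rewrite /D !mulmxDl !mul1mx -!scalemxAl !mul1mx mulmxBr -scalemxAr.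
set x := y - s; rewrite [X in X - _](_ : _ = x + s + K *m s); last by rewrite subrK.
rewrite scalerDl scale1r; apply/matrixP => i j; rewrite !mxE; ring.
Qed.

(** * Antitransposition *)

Section Duality.
Variables (K : comPzRingType) (N : nat).
Implicit Types (B : 'M[K]_N.+1) (z : 'cV[K]_N.+1).

(** Both sides are the value of the bilinear form of [B] at the reversal of [z']
    and [z], evaluated by applying [B] to the right or to the left first. *)
Lemma antitranspose_reciprocity B z z' a a' :
  B *m z = a *: delta_mx ord0 ord0 ->
  \matrix_(i, j) B (rev_ord j) (rev_ord i) *m z' = a' *: delta_mx ord0 ord0 ->
  a * z' ord_max ord0 = a' * z ord_max ord0.
Proof.
move=> /matrixP E /matrixP E'.
have r0 : rev_ord (ord0 : 'I_N.+1) = ord_max by apply/val_inj; rewrite /= subn1.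
transitivity (\sum_i \sum_j z' (rev_ord i) ord0 * B i j * z j ord0).
  rewrite (bigD1 ord0) //= [X in _ + X]big1 ?addr0 => [|i i0].
    rewrite r0 mulrC; transitivity (z' ord_max ord0 * (B *m z) ord0 ord0).
      by rewrite E !mxE eqxx mulr1.
    by rewrite mxE mulr_sumr; apply: eq_bigr => j _; rewrite mulrA.
  transitivity (z' (rev_ord i) ord0 * (B *m z) i ord0).
    by rewrite mxE mulr_sumr; apply: eq_bigr => j _; rewrite mulrA.
  by rewrite E !mxE (negbTE i0) mulr0 mulr0.
have E'r j : \sum_i z' (rev_ord i) ord0 * B i j = a' * (j == ord_max)%:R.
  transitivity ((a' *: delta_mx ord0 ord0 : 'cV[K]_N.+1) (rev_ord j) ord0).
    rewrite -E' mxE [RHS](reindex_inj rev_ord_inj); apply: eq_bigr => i _.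
    by rewrite mxE !rev_ordK mulrC.
  by rewrite !mxE andbT (can2_eq rev_ordK rev_ordK) r0.
rewrite exchange_big (bigD1 ord_max) //= [X in _ + X]big1 ?addr0 => [|j jm].
  by rewrite -mulr_suml E'r eqxx mulr1.
by rewrite -mulr_suml E'r (negbTE jm) mulr0 mul0r.
Qed.
End Duality.

Lemma antitrmxE (R : realType) (N : nat) (X : 'M[R]_N.+1) :
  antitrmx X = \matrix_(i, j) X (rev_ord j) (rev_ord i).
Proof.
apply/matrixP => i j; rewrite !mxE (bigD1 (rev_ord j)) //= big1 ?addr0.
  rewrite !mxE eqxx mulr1 (bigD1 (rev_ord i)) //= big1 ?addr0 => [|k kj].
    by rewrite !mxE rev_ordK eqxx mul1r.
  rewrite !mxE; case: eqP => [ik|]; last by rewrite mul0r.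
  by rewrite ik rev_ordK eqxx in kj.
by move=> k /negbTE kj; rewrite !mxE kj mulr0.
Qed.

Lemma antitrmxK (R : realType) (N : nat) : involutive (@antitrmx R N).
Proof. by move=> X; apply/matrixP => i j; rewrite !antitrmxE !mxE !rev_ordK. Qed.

Lemma strictly_lower_antitrmx (R : realType) (N : nat) (X : 'M[R]_N.+1) :
  strictly_lower X -> strictly_lower (antitrmx X).
Proof. by move=> hX i j ij; rewrite antitrmxE mxE hX //= leq_sub2l. Qed.

(** [diffmx] is a Toeplitz matrix, hence persymmetric. *)
Lemma diffmx_antitr (K : pzRingType) (N : nat) (i j : 'I_N.+1) :
  diffmx K N (rev_ord j) (rev_ord i) = diffmx K N i j.
Proof.
rewrite !mxE (inj_eq rev_ord_inj) eq_sym; congr (_ - _%:R).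
rewrite /= !subSS; move: (ltn_ord i) (ltn_ord j); rewrite !ltnS => iN jN.
by congr (nat_of_bool _); apply/eqP/eqP; lia.
Qed.

(** * Values of the quadratic forms on complex trajectories *)

Section ComplexTrajectories.
Local Open Scope complex_scope.
Variables (R : realType).
Local Notation C := R[i].
Local Notation Re := (@complex.Re R).
Local Notation Im := (@complex.Im R).

(** The squared modulus as a real number; the norm of [R[i]] takes its values
    in [R[i]]. *)
Definition sqabs (z : C) : R := Re z ^+ 2 + Im z ^+ 2.

Lemma sqabsM z w : sqabs (z * w) = sqabs z * sqabs w.
Proof. by case: z w => [a b] [c d]; rewrite /sqabs /=; ring. Qed.

Lemma sqabs_gt0 z : z != 0 -> 0 < sqabs z.
Proof.
case: z => a b; rewrite eq_complex /= negb_and /sqabs /= => ab.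
rewrite lt_neqAle eq_sym paddr_eq0 ?sqr_ge0 // !sqrf_eq0 negb_and ab /=.
by rewrite addr_ge0 ?sqr_ge0.
Qed.

Lemma dformE M (sigma : C) : M^T = M ->
  dform M sigma = (M 0 0 + 2 * M 0 1 * Re sigma + M 1 1 * sqabs sigma)%:C.
Proof.
move=> /matrixP/(_ 0 1); rewrite mxE => M10.
have o1 : lift ord0 ord0 = 1 :> 'I_2 by apply/val_inj.
rewrite /dform /dvec !mxE !big_ord_recl big_ord0 !mxE !big_ord_recl !big_ord0.
rewrite !mxE /= o1 M10.
case: sigma => a b; apply/eqP; rewrite eq_complex /sqabs /=; apply/andP.
by split; apply/eqP; rewrite /=; ring.
Qed.

Lemma dform_real M (sigma : C) : M^T = M -> dform M sigma = (Re (dform M sigma))%:C.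
Proof. by move=> /dformE ->. Qed.

(** For sigma = a + i b the form splits as M(1, a) + M(0, b). *)
Lemma Re_dform_ge0 M (sigma : C) : psd2 M -> 0 <= Re (dform M sigma).
Proof.
move=> [MT pM]; rewrite dformE //=.
have M10 : M 1 0 = M 0 1 by move/matrixP/(_ 0 1): MT; rewrite mxE.
have o1 : lift ord0 ord0 = 1 :> 'I_2 by apply/val_inj.
have := pM (\col_i (if i == 0 then 1 else Re sigma)).
have := pM (\col_i (if i == 0 then 0 else Im sigma)).
rewrite !mxE !big_ord_recl !big_ord0 !mxE !big_ord_recl !big_ord0 !mxE /= o1 M10.
rewrite /sqabs; lra.
Qed.

Lemma Re_dform_gt0 M (sigma : C) :
  psd2 M -> dform M sigma != 0 -> 0 < Re (dform M sigma).
Proof.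
move=> pM; have [MT _] := pM; rewrite lt_neqAle Re_dform_ge0 // andbT.
by apply: contra => /eqP E; rewrite dform_real // -E.
Qed.

Lemma eq_ratio_cross (a b c d : C) :
  a = (Re a)%:C -> b = (Re b)%:C -> c = (Re c)%:C -> d = (Re d)%:C ->
  b != 0 -> d != 0 -> a / b = c / d -> Re a * Re d = Re c * Re b.
Proof.
move=> aE bE cE dE b0 d0 /eqP; rewrite eqr_div // aE bE cE dE -!rmorphM.
by move=> /eqP/complexI.
Qed.

Lemma QformE d M (y s : 'rV[R]_d) : M^T = M ->
  Qform M y s = \sum_j (M 0 0 * y 0 j ^+ 2 + 2 * M 0 1 * (y 0 j * s 0 j)
                        + M 1 1 * s 0 j ^+ 2).
Proof.
move=> /matrixP/(_ 0 1); rewrite mxE => M10.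
have o1 : lift ord0 ord0 = 1 :> 'I_2 by apply/val_inj.
have yE j : (col_mx y s : 'M_(2, d)) ord0 j = y 0 j.
  by rewrite -(col_mxEu y s); congr (col_mx y s _ j); apply/val_inj.
have sE j : (col_mx y s : 'M_(2, d)) 1 j = s 0 j.
  by rewrite -(col_mxEd y s); congr (col_mx y s _ j); apply/val_inj.
rewrite /Qform /mxtrace; apply: eq_bigr => j _.
rewrite mxE; under eq_bigr => k _.
  rewrite mxE; under eq_bigr => l _ do rewrite mxE.
  over.
rewrite !big_ord_recl !big_ord0 o1 yE sE M10; ring.
Qed.

Lemma realify_re N (z : 'cV[C]_N.+1) i : realify z i 0 = Re (z i ord0).
Proof.
rewrite /realify; set A := map_mx _ z; set B := map_mx _ z.
have -> : (0 : 'I_2) = lshift 1 (ord0 : 'I_1) by apply/val_inj.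
by rewrite (row_mxEl A B) mxE.
Qed.

Lemma realify_im N (z : 'cV[C]_N.+1) i : realify z i 1 = Im (z i ord0).
Proof.
rewrite /realify; set A := map_mx _ z; set B := map_mx _ z.
have -> : (1 : 'I_2) = rshift 1 (ord0 : 'I_1) by apply/val_inj.
by rewrite (row_mxEr A B) mxE.
Qed.

Lemma Qform_realify N M sigma (z : 'cV[C]_N.+1) i : M^T = M ->
  Qform M (row i (realify z)) (row i (realify (sigma *: z))) =
  sqabs (z i ord0) * Re (dform M sigma).
Proof.
move=> MT; rewrite dformE // QformE // big_ord_recl big_ord1.
rewrite [lift _ _](_ : _ = 1); last exact/val_inj.
rewrite ![row _ _ _ _]mxE !realify_re !realify_im !mxE.
by case: (z i _) => a b; case: sigma => c d; rewrite /sqabs /=; ring.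
Qed.

Lemma Qform_real N M sigma (y : 'cV[R]_N.+1) i : M^T = M ->
  Qform M (row i y) (row i (sigma *: y)) =
  sqabs (y i ord0)%:C * Re (dform M sigma%:C).
Proof.
by move=> MT; rewrite dformE // QformE // big_ord1 !mxE /sqabs /=; ring.
Qed.

(** * Extremal trajectories as solutions of a complex linear system *)

Variable N : nat.
Implicit Types (Ht : 'M[R]_N.+1) (z : 'cV[C]_N.+1).

Lemma eq_two_columns (A B : 'M[R]_(N.+1, 2)) :
  (forall i, A i 0 = B i 0) -> (forall i, A i 1 = B i 1) -> A = B.
Proof.
move=> E0 E1; apply/matrixP => i j.
have [->|j1] := eqVneq j 0; first exact: E0.
suff -> : j = 1 by exact: E1.
by apply/val_inj; case: j j1 => [[|[]]].
Qed.

Lemma realifyD z w : realify (z + w) = realify z + realify w.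
Proof.
by apply: eq_two_columns => i; rewrite [RHS]mxE ?realify_re ?realify_im !mxE;
   case: (z i ord0) (w i ord0) => [? ?] [].
Qed.

Lemma realify_inj : injective (@realify R N).
Proof.
move=> z w /matrixP E; apply/matrixP => i j; rewrite ord1.
move: (E i 0) (E i 1); rewrite !realify_re !realify_im.
by case: (z i _) (w i _) => [? ?] [? ?] /= -> ->.
Qed.

Lemma realify_real_mul (A : 'M[R]_N.+1) z :
  realify (map_mx (real_complex R) A *m z) = A *m realify z.
Proof.
apply: eq_two_columns => i; rewrite [RHS]mxE ?realify_re ?realify_im mxE.
  rewrite (big_morph Re (id1 := 0) (op1 := +%R)) //; last by case=> [? ?] [].
  apply: eq_bigr => k _; rewrite realify_re mxE.
  by case: (z k ord0) => a b /=; ring.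
rewrite (big_morph Im (id1 := 0) (op1 := +%R)) //; last by case=> [? ?] [].
apply: eq_bigr => k _; rewrite realify_im mxE.
by case: (z k ord0) => a b /=; ring.
Qed.

Lemma realify_scale_delta z :
  realify (z ord0 ord0 *: delta_mx ord0 ord0) =
  (delta_mx ord0 ord0 : 'cV[R]_N.+1) *m row ord0 (realify z).
Proof.
apply: eq_two_columns => i; rewrite [RHS]mxE big_ord1 [row _ _ _ _]mxE.
  by rewrite !realify_re !mxE; case: (_ && _);
     rewrite ?(mulr1, mul1r, mulr0, mul0r).
by rewrite !realify_im !mxE; case: (_ && _);
   rewrite ?(mulr1, mul1r, mulr0, mul0r).
Qed.

Definition stepmx Ht (sigma : C) : 'M[C]_N.+1 :=
  diffmx C N + sigma *: map_mx (real_complex R) Ht.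

(** Trajectories of both settings are treated as complex columns; the start
    [z ord0 ord0] is left free. *)
Definition trajectory Ht sigma z : Prop :=
  stepmx Ht sigma *m z = z ord0 ord0 *: delta_mx ord0 ord0.

Lemma map_diffmx : map_mx (real_complex R) (diffmx R N) = diffmx C N.
Proof. by apply/matrixP => i j; rewrite !mxE rmorphB !rmorph_nat. Qed.

Lemma iterates_realify Ht sigma z : strictly_lower Ht ->
  iterates Ht (realify z) (realify (sigma *: z)) <-> trajectory Ht sigma z.
Proof.
move=> hHt; rewrite (iteratesP _ _ hHt) -realify_scale_delta.
rewrite -!realify_real_mul -realifyD map_diffmx /trajectory /stepmx.
by rewrite mulmxDl -scalemxAl -scalemxAr; split=> [/realify_inj|->].
Qed.

Lemma iterates_real Ht (sigma : R) (y : 'cV[R]_N.+1) : strictly_lower Ht ->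
  iterates Ht y (sigma *: y) ->
  trajectory Ht sigma%:C (map_mx (real_complex R) y).
Proof.
move=> hHt /(iteratesP _ _ hHt) /(congr1 (map_mx (real_complex R))).
rewrite /trajectory /stepmx map_mxD !map_mxM map_diffmx map_mxZ mulmxDl.
rewrite -scalemxAl -scalemxAr => ->.
rewrite map_delta_mx; apply/matrixP => i j; rewrite !mxE big_ord1 !mxE eqxx.
by rewrite !ord1 andbT mulrC.
Qed.

(** The system is lower triangular with unit diagonal. *)
Lemma trajectory_exists Ht sigma : strictly_lower Ht ->
  exists z, trajectory Ht sigma z /\ z ord0 ord0 = 1.
Proof.
move=> hHt.
have BE (i j : 'I_N.+1) : (i <= j)%N -> stepmx Ht sigma i j = (i == j)%:R.
  move=> ij; rewrite !mxE hHt // rmorph0 mulr0 addr0.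
  by rewrite (ltn_eqF (ij : (i < j.+1)%N)) subr0.
have Bu : stepmx Ht sigma \in unitmx.
  rewrite unitmxE det_trig ?unitfE.
    by apply/prodf_neq0 => i _; rewrite BE // eqxx oner_neq0.
  by apply/is_trig_mxP => i j ij; rewrite BE 1?ltnW // -val_eqE (ltn_eqF ij).
pose z := invmx (stepmx Ht sigma) *m (delta_mx ord0 ord0 : 'cV[C]_N.+1).
have Bz : stepmx Ht sigma *m z = delta_mx ord0 ord0 by rewrite mulKVmx.
have z0 : z ord0 ord0 = 1.
  move/matrixP/(_ ord0 ord0): Bz; rewrite mxE (bigD1 ord0) //= big1.
    by rewrite BE // !mxE !eqxx mul1r addr0.
  by move=> i i0; rewrite BE // eq_sym (negbTE i0) mul0r.
by exists z; split => //; rewrite /trajectory z0 scale1r.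
Qed.

Lemma trajectory_antitr Ht sigma z z' :
  trajectory Ht sigma z -> trajectory (antitrmx Ht) sigma z' ->
  z ord0 ord0 * z' ord_max ord0 = z' ord0 ord0 * z ord_max ord0.
Proof.
move=> tz tz'; apply: (antitranspose_reciprocity tz).
rewrite -tz'; congr (_ *m _); apply/matrixP => i j.
by rewrite mxE /stepmx mxE diffmx_antitr antitrmxE !mxE.
Qed.

End ComplexTrajectories.

(** * Bounds on the rate *)

Section Rates.
Local Open Scope complex_scope.
Variables (R : realType) (N : nat) (mu : R).
Hypothesis mu01 : 0 <= mu < 1.
Local Notation C := R[i].
Local Notation Re := (@complex.Re R).
Local Notation Im := (@complex.Im R).
Implicit Types (Ht L : 'M[R]_N.+1) (z : 'cV[C]_N.+1) (sigma : C).

(** The segment from mu to 1 is a diameter of the circle, so sigma sees it under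
    a right angle; this is the orthogonality of x and g. *)
Lemma OmegaOp_circle sigma : OmegaOp mu sigma ->
  (Re sigma - mu) * (1 - Re sigma) = Im sigma ^+ 2.
Proof.
rewrite /OmegaOp /= normc_def => /complexI /(congr1 (fun r => r ^+ 2)).
rewrite sqr_sqrtr ?addr_ge0 ?sqr_ge0 //.
case: sigma => a b /= E.
have {}E : (a - (1 + mu) / 2) ^+ 2 + b ^+ 2 = ((1 - mu) / 2) ^+ 2.
  by rewrite -E; ring.
by lra.
Qed.

(** The trace is the sum of L i j p i j, where p i j is the scalar product in
    R^2 of g_i and x_j.  In the function setting g = 0 or x = 0; in the operator
    setting p is antisymmetric while L is symmetric. *)
Lemma trace_extremal st L sigma z :
  (if st is operator_setting then L^T = L else True) -> Omega st mu sigma ->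
  let y := realify z in let s := realify (sigma *: z) in
  \tr ((s - qof mu *: (y - s))^T *m L *m (y - s)) = 0.
Proof.
move=> LT Os y s; set x := y - s; set g := s - _ *: x.
have mu1 : 1 - mu != 0 by case/andP: mu01 => _ ?; rewrite gt_eqF ?subr_gt0.
pose p i j := g i 0 * x j 0 + g i 1 * x j 1.
have -> : \tr (g^T *m L *m x) = \sum_i \sum_j L i j * p i j.
  rewrite /mxtrace; under eq_bigr => k _.
    rewrite mxE; under eq_bigr => j _.
      rewrite mxE mulr_suml; over.
    over.
  rewrite exchange_big [RHS]exchange_big; apply: eq_bigr => j _.
  rewrite exchange_big; apply: eq_bigr => i _.
  rewrite big_ord_recl big_ord1 [lift _ _](_ : _ = 1); last exact/val_inj.
  rewrite /= ![_^T _ _]mxE (_ : ord0 = 0 :> 'I_2) /p; last exact/val_inj.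
  by ring.
have yE i : (y i 0 = Re (z i ord0)) * (y i 1 = Im (z i ord0)).
  by rewrite /y realify_re realify_im.
have sE i : (s i 0 = Re (sigma * z i ord0)) * (s i 1 = Im (sigma * z i ord0)).
  by rewrite /s realify_re realify_im !mxE.
have xE i k : x i k = y i k - s i k by rewrite !mxE.
have gE i k : g i k = s i k - qof mu * (y i k - s i k) by rewrite !mxE.
case: st LT Os => [_ [r Or <-]|LT /OmegaOp_circle circ] in sE *.
  apply: big1 => i _; apply: big1 => j _; rewrite /p !xE !gE !yE !sE.
  case: (z i _) (z j _) => [a b] [c d] /=; rewrite /qof.
  by case: Or => ->; field.
(* p i j + p j i is the scalar product of the two multipliers, which vanishes by
   the circle condition, times 2 Re (conj z_i z_j). *)
have anti i j : p j i = - p i j.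
  apply/eqP; rewrite -addr_eq0 /p !xE !gE !yE !sE.
  move: circ; case: (sigma) => u v /=; case: (z i _) (z j _) => [a b] [c d] /= circ.
  rewrite [X in X == 0](_ : _ = 2 * ((u - mu) * (1 - u) - v ^+ 2) / (1 - mu)
                                * (a * c + b * d)).
    by rewrite circ subrr mulr0 !mul0r.
  by rewrite /qof; field.
have : \sum_i \sum_j L i j * p i j = - \sum_i \sum_j L i j * p i j.
  rewrite {1}exchange_big -sumrN; apply: eq_bigr => j _.
  rewrite -sumrN; apply: eq_bigr => i _.
  by rewrite anti mulrN -[in LHS]LT mxE.
lra.
Qed.

(** The slack is tested on the trajectory embedded in R^2, in both settings;
    its trace term vanishes. *)
Lemma certifies_bound st M0 MN Ht tau L sigma z :
  strictly_lower Ht -> M0^T = M0 -> MN^T = MN -> 0 < tau ->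
  certifies st mu M0 MN tau Ht L -> Omega st mu sigma ->
  trajectory Ht sigma z ->
  sqabs (z ord_max ord0) * Re (dform MN sigma) <=
  tau ^+ 2 * (sqabs (z ord0 ord0) * Re (dform M0 sigma)).
Proof.
move=> hHt M0T MNT tau0 [_ LT slack] Os /(iterates_realify _ _ hHt) it.
pose y := realify z; pose s := realify (sigma *: z).
have := slack _ (row ord0 y) (s - qof mu *: (y - s)).
have xE : xmx mu Ht (row ord0 y) (s - qof mu *: (y - s)) = y - s.
  exact: xmx_iterates.
have sE : smx mu Ht (row ord0 y) (s - qof mu *: (y - s)) = s.
  by rewrite /smx xE subrK.
have yE : ymx mu Ht (row ord0 y) (s - qof mu *: (y - s)) = y.
  by rewrite /ymx xE sE subrK.
rewrite /Slack xE sE yE (trace_extremal z LT Os) addr0 !Qform_realify //.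
set B := _ * Re (dform MN _); set A := _ * Re (dform M0 _) => ge0.
have : 0 <= 2 * tau * (tau / 2 * A - 1 / (2 * tau) * B).
  by rewrite mulr_ge0 // mulr_ge0 // ltW.
rewrite [X in 0 <= X](_ : _ = tau ^+ 2 * A - B) ?subr_ge0 //.
by field; rewrite gt_eqF.
Qed.

(** Every certified tau is at least the square root of the ratio of the two
    forms, hence so is the infimum. *)
Lemma tauPEP_bound st M0 MN Ht tau sigma z :
  strictly_lower Ht -> psd2 M0 -> psd2 MN -> tauPEP st mu M0 MN Ht = tau%:E ->
  Omega st mu sigma -> dform M0 sigma != 0 ->
  trajectory Ht sigma z -> z ord0 ord0 != 0 ->
  sqabs (z ord_max ord0) * Re (dform MN sigma) <=
  tau ^+ 2 * (sqabs (z ord0 ord0) * Re (dform M0 sigma)).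
Proof.
move=> hHt pM0 pMN tauE Os M0n tz z0.
have [[M0T _] [MNT _]] := (pM0, pMN).
have bound t L (t0 : 0 < t) (cL : certifies st mu M0 MN t Ht L) :=
  certifies_bound hHt M0T MNT t0 cL Os tz.
move: bound; set B := _ * Re (dform MN _); set A := _ * Re (dform M0 _) => bound.
have A0 : 0 < A by rewrite mulr_gt0 ?sqabs_gt0 ?Re_dform_gt0.
have B0 : 0 <= B by rewrite mulr_ge0 ?Re_dform_ge0 // addr_ge0 ?sqr_ge0.
clearbody A B; have BA0 : 0 <= B / A by rewrite divr_ge0 // ltW.
rewrite -ler_pdivrMr // -(sqr_sqrtr BA0).
have le : Num.sqrt (B / A) <= tau.
  rewrite -lee_fin -tauE; apply: le_ereal_inf_tmp => _ [t [t0 [L cL]] <-].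
  rewrite lee_fin -[leRHS]gtr0_norm // -sqrtr_sqr ler_wsqrtr // ler_pdivrMr //.
  exact: bound cL.
by rewrite ler_pXn2r ?nnegrE ?sqrtr_ge0 // (le_trans _ le) ?sqrtr_ge0.
Qed.

(** Real trajectories of the function setting become complex ones with real
    sigma, so that a single equality describes both settings. *)
Lemma extremal_attained st M0 MN Ht :
  strictly_lower Ht -> M0^T = M0 -> MN^T = MN -> extremal st mu M0 MN Ht ->
  exists tau sigma z, [/\ 0 < tau, tauPEP st mu M0 MN Ht = tau%:E,
    Omega st mu sigma, trajectory Ht sigma z & z ord0 ord0 != 0 /\
    sqabs (z ord_max ord0) * Re (dform MN sigma) =
    tau ^+ 2 * (sqabs (z ord0 ord0) * Re (dform M0 sigma))].
Proof.
move=> hHt M0T MNT [tau [tau0 tauE ext]].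
have clear_den A B : tau / 2 * A - 1 / (2 * tau) * B = 0 -> B = tau ^+ 2 * A.
  move=> E; apply/eqP; rewrite eq_sym -subr_eq0.
  have -> : tau ^+ 2 * A - B = 2 * tau * (tau / 2 * A - 1 / (2 * tau) * B).
    by field; rewrite gt_eqF.
  by rewrite E mulr0.
case: st ext tauE => [] [sigma [y [Os [it y0 E]]]] tauE.
  exists tau, sigma%:C, (map_mx (real_complex R) y); split => //.
  - by exists sigma.
  - exact: iterates_real.
  rewrite !mxE; split.
    apply: contra y0 => /eqP/complexI y00.
    by apply/eqP/matrixP => i j; rewrite !mxE ord1.
  by move/clear_den: E; rewrite !Qform_real.
exists tau, sigma, y; split => //; first exact/iterates_realify.
split; last by move/clear_den: E; rewrite !Qform_realify.
apply: contra y0 => /eqP y00; apply/eqP/matrixP => i j; rewrite mxE [RHS]mxE.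
have [->|j1] := eqVneq j 0; first by rewrite realify_re y00.
suff -> : j = 1 by rewrite realify_im y00.
by apply/val_inj; case: j j1 => [[|[]]].
Qed.

(** The final comparison: c = |z_0|^2, r = |z'_N|^2 with z'_0 = 1, and
    c r = |z_N|^2 by reciprocity. *)
Lemma le_of_eq_ratio (c r w0 wN w0' wN' tau tau' : R) :
  0 < c -> 0 < tau -> 0 < tau' -> 0 < w0 -> 0 < w0' -> wN * w0' = wN' * w0 ->
  c * r * wN = tau ^+ 2 * (c * w0) -> r * wN' <= tau' ^+ 2 * w0' -> tau <= tau'.
Proof.
move=> c0 tau0 tau'0 w0_gt0 w0'_gt0 cross att bound.
have {}att : r * wN = tau ^+ 2 * w0.
  by apply: (mulfI (lt0r_neq0 c0)); rewrite mulrA att; ring.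
rewrite -(ler_pXn2r (ltn0Sn 1)) ?nnegrE ?(ltW tau0) ?(ltW tau'0) //.
rewrite -(ler_pM2r w0'_gt0) -(ler_pM2r w0_gt0).
have -> : tau ^+ 2 * w0' * w0 = r * wN' * w0.
  by rewrite -[RHS]mulrA -cross [RHS]mulrA att mulrAC.
by rewrite ler_pM2r.
Qed.

(** At a sigma where the rate of [Ht] is attained, a trajectory of the
    antitranspose has the same ratio |z_N / z_0| and the same ratio of forms, and
    the lower bound on the second rate applies to it. *)
Lemma tauPEP_le_antitrmx st M0 MN M0' MN' Ht :
  psd2 M0 -> psd2 MN -> psd2 M0' -> psd2 MN' -> strictly_lower Ht ->
  extremal st mu M0 MN Ht -> extremal st mu M0' MN' (antitrmx Ht) ->
  (forall sigma, Omega st mu sigma ->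
     dform M0 sigma != 0 /\ dform M0' sigma != 0) ->
  (forall sigma, Omega st mu sigma ->
     dform MN sigma / dform M0 sigma = dform MN' sigma / dform M0' sigma) ->
  (tauPEP st mu M0 MN Ht <= tauPEP st mu M0' MN' (antitrmx Ht))%E.
Proof.
move=> pM0 pMN pM0' pMN' hHt ext [tau' [tau'0 tau'E _]] den ratio.
have [[M0T _] [MNT _]] := (pM0, pMN).
have [[M0T' _] [MNT' _]] := (pM0', pMN').
have [tau [sigma [z [tau0 tauE Os tz [z0 attained]]]]] :=
  extremal_attained hHt M0T MNT ext.
have [M0n M0n'] := den _ Os.
have hHt' := strictly_lower_antitrmx hHt.
have [z' [tz' z'0]] := trajectory_exists sigma hHt'.
have z'1 : z' ord0 ord0 != 0 by rewrite z'0 oner_neq0.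
have bound := tauPEP_bound hHt' pM0' pMN' tau'E Os M0n' tz' z'1.
have zN := trajectory_antitr tz tz'; rewrite z'0 mul1r in zN.
rewrite -zN sqabsM in attained.
rewrite z'0 (_ : sqabs 1 = 1) ?mul1r in bound; last first.
  by rewrite /sqabs /= expr1n expr0n addr0.
rewrite tauE tau'E lee_fin.
have w0_gt0 := Re_dform_gt0 pM0 M0n.
have w0'_gt0 := Re_dform_gt0 pM0' M0n'.
have cross := eq_ratio_cross (dform_real sigma MNT) (dform_real sigma M0T)
  (dform_real sigma MNT') (dform_real sigma M0T') M0n M0n' (ratio _ Os).
exact: (le_of_eq_ratio (sqabs_gt0 z0) tau0 tau'0 w0_gt0 w0'_gt0 cross attained).
Qed.

End Rates.

(** * Equality of the rates *)

Theorem theorem1 (R : realType) (N : nat) (hN : (1 <= N)%N)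
  (mu : R) (hmu0 : 0 <= mu) (hmu1 : mu < 1)
  (st : setting)
  (M0 MN M0' MN' : 'M[R]_2)
  (hM0 : psd2 M0) (hMN : psd2 MN) (hM0' : psd2 M0') (hMN' : psd2 MN')
  (Ht : 'M[R]_N.+1) (hHt : strictly_lower Ht)
  (hext : extremal st mu M0 MN Ht)
  (hext' : extremal st mu M0' MN' (antitrmx Ht))
  (hden : forall sigma : R[i], Omega st mu sigma ->
     dform M0 sigma != 0 /\ dform M0' sigma != 0)
  (hratio : forall sigma : R[i], Omega st mu sigma ->
     dform MN sigma / dform M0 sigma = dform MN' sigma / dform M0' sigma) :
  tauPEP st mu M0 MN Ht = tauPEP st mu M0' MN' (antitrmx Ht).
Proof.
have mu01 : 0 <= mu < 1 by rewrite hmu0.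
apply/le_anti/andP; split; first exact: tauPEP_le_antitrmx.
have hext2 : extremal st mu M0 MN (antitrmx (antitrmx Ht)) by rewrite antitrmxK.
have hden2 sigma (Os : Omega st mu sigma) :
    dform M0' sigma != 0 /\ dform M0 sigma != 0.
  by have [? ?] := hden sigma Os.
have hratio2 sigma (Os : Omega st mu sigma) := esym (hratio sigma Os).
have := tauPEP_le_antitrmx mu01 hM0' hMN' hM0 hMN
  (strictly_lower_antitrmx hHt) hext' hext2 hden2 hratio2.
by rewrite antitrmxK.
Qed.
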